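(* Let $f:\mathbb{R}^n\to\mathbb{R}$ be differentiable with Lipschitz continuous gradient $\nabla f:\mathbb{R}^n\to\mathbb{R}^n$ with Lipschitz constant $L>0$ (A1), and suppose there exists $f_{low}\in\mathbb{R}$ with $f(x)\ge f_{low}$ for all $x\in\mathbb{R}^n$ (A2). Consider Algorithm 1 (described in the context) with $x_0\in\mathbb{R}^n$, $\alpha_0,\sigma,\theta>0$, $\beta,\rho\in(0,1)$, $M\in\mathbb{N}\setminus\{0\}$, and suppose there exist constants $c_1,c_2>0$ such that the search directions satisfy $$\langle\nabla f(x_k),d_k\rangle\le -c_1\|\nabla f(x_k)\|^2\quad\text{and}\quad \|d_k\|\le c_2\|\nabla f(x_k)\|\quad\text{for all }k\ge 0\qquad\text{(A3)}.$$ Then Algorithm 1 is well-defined, and any sequence $\{x_k\}_{k\ge0}$ generated by it satisfies, for all integers $T\ge 1$, $$\min_{k=0,\ldots,T-1}\|\nabla f(x_k)\|^2\le\begin{cases}\dfrac{\tilde L(f(x_0)-f_{low})}{T}+\dfrac{\tilde L\sigma\theta}{(\theta-1)}\dfrac1T, & \text{if }\theta>1,\\[2mm] \dfrac{\tilde L(f(x_0)-f_{low})}{T}+\tilde L\sigma\left(\dfrac{1+\ln(T)}{T}\right), & \text{if }\theta=1,\\[2mm] \dfrac{\tilde L(f(x_0)-f_{low})}{T}+\dfrac{\tilde L\sigma}{(1-\theta)}\dfrac1{T^{\theta}}, & \text{if }\theta\in(0,1),\end{cases}$$ where $$\tilde L=\max\left\{\frac{1}{\rho\beta\alpha_0c_1},\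 \frac{L}{2\rho(1-\rho)\beta}\left(\frac{c_2}{c_1}\right)^2\right\}.$$
   Context: Here $\langle\cdot,\cdot\rangle$ is the Euclidean inner product on $\mathbb{R}^n$ and $\|\cdot\|$ the Euclidean norm. Algorithm 1 (non-monotone line-search with modified Metropolis-based relaxation term). Step 0. Given $x_0\in\mathbb{R}^n$, $\alpha_0,\sigma,\theta>0$, $\beta,\rho\in(0,1)$ and $M\in\mathbb{N}\setminus\{0\}$, set $m(0)=0$ and $k:=0$. Step 1. Compute a search direction $d_k\in\mathbb{R}^n$ with $\langle\nabla f(x_k),d_k\rangle<0$, and set $i:=0$. Step 2.1. Compute $x_{k,i}^+=x_k+\beta^i\alpha_kd_k$ and $$\nu_{k,i}=\sigma\cdot\exp\left(-\max\left\{\theta,\ \frac{f_{l(k)}-f(x_{k,i}^+)}{\rho\beta^i\alpha_k\langle\nabla f(x_k),d_k\rangle}\right\}\ln(k+1)\right),$$ where $f_{l(k)}=\max_{0\le j\le m(k)}f(x_{k-j})$. Step 2.2. If $$f(x_{k,i}^+)\le f(x_k)+\rho\beta^i\alpha_k\langle\nabla f(x_k),d_k\rangle+\nu_{k,i},$$ set $i_k=i$, $\nu_k=\nu_{k,i_k}$ and go to Step 3. Otherwise set $i:=i+1$ and go back to Step 2.1. Step 3. Define $x_{k+1}=x_{k,i_k}^+$, $\alpha_{k+1}=\beta^{i_k-1}\alpha_k$, $m(k+1)=\min\{m(k)+1,M\}$, set $k:=k+1$ and go to Step 1. A sequence $\{x_k\}_{k\ge0}$ generated by Algorithm 1 is an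 infinite sequence of iterates obtained by executing these steps for $k=0,1,2,\ldots$; in particular, by Step 1, $\langle\nabla f(x_k),d_k\rangle<0$ for every $k$. ''Well-defined'' means that at every iteration $k$ the inner loop of Step 2 terminates: there is a finite $i\ge0$ for which the acceptance inequality in Step 2.2 holds, so that $x_{k+1}$, $\nu_k$ and $\alpha_{k+1}$ are well-defined. *)

(* Defs.v *)
From HB Require Import structures.
From mathcomp Require Import all_boot all_order all_algebra.
From mathcomp Require Import all_classical all_reals all_analysis.
Set Implicit Arguments.
Unset Strict Implicit.
Unset Printing Implicit Defensive.
Import Order.TTheory GRing.Theory Num.Theory.
Import numFieldNormedType.Exports.
Local Open Scope ring_scope.

Definition dot {R : realType} {n : nat} (u v : 'rV[R]_n) : R :=
  \sum_(j < n) u 0 j * v 0 j.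

(* The library norm `|u| on row vectors is the sup norm, hence this one. *)
Definition enorm {R : realType} {n : nat} (u : 'rV[R]_n) : R :=
  Num.sqrt (dot u u).

Definition grad {R : realType} {n : nat} (f : 'rV[R]_n -> R) (x : 'rV[R]_n) :
    'rV[R]_n :=
  \row_(j < n) 'D_(delta_mx 0 j) f x.

(* The memory lengths m(k): m(0) = 0 and m(k+1) = min (m(k) + 1, M). *)
Fixpoint memory (M k : nat) : nat :=
  if k is k'.+1 then minn (memory M k').+1 M else 0%N.

(* The quantities produced by an execution: iterates x_k, initial step sizes
   alpha_k, directions d_k and accepted backtracking indices i_k. Being total,
   these sequences carry meaningless values beyond the iterations performed. *)
Record execution (R : realType) (n : nat) := Execution {
  iter_x : nat -> 'rV[R]_n;
  iter_alpha : nat -> R;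
  iter_d : nat -> 'rV[R]_n;
  iter_i : nat -> nat
}.

Section Algorithm.
Context {R : realType} {n : nat}.
Implicit Types (f : 'rV[R]_n -> R) (s : execution R n).
Implicit Types (sigma theta beta rho : R) (M k i : nat).

Definition slope f s k : R := dot (grad f (iter_x s k)) (iter_d s k).

(* As memory M k <= k, the subtraction is never truncated; the default value
   of the maximum is its own j = 0 term. *)
Definition f_l f M s k : R :=
  \big[Num.max/f (iter_x s k)]_(0 <= j < (memory M k).+1) f (iter_x s (k - j)).

Definition trial beta s k i : 'rV[R]_n :=
  iter_x s k + (beta ^+ i * iter_alpha s k) *: iter_d s k.

Definition nu f sigma theta beta rho M s k i : R :=
  sigma * expR (- (Num.max theta
    ((f_l f M s k - f (trial beta s k i)) /
     (rho * beta ^+ i * iter_alpha s k * slope f s k)) * ln (k.+1%:R))).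

Definition accepted f sigma theta beta rho M s k i : Prop :=
  f (trial beta s k i) <=
    f (iter_x s k) + rho * beta ^+ i * iter_alpha s k * slope f s k
    + nu f sigma theta beta rho M s k i.

Definition initialized (x0 : 'rV[R]_n) (alpha0 : R) s : Prop :=
  iter_x s 0%N = x0 /\ iter_alpha s 0%N = alpha0.

Definition descent_direction f s k : Prop := slope f s k < 0.

(* The line search stops at the first accepted index. The exponent i_k - 1 is
   an integer, equal to -1 when i_k = 0. *)
Definition iteration f sigma theta beta rho M s k : Prop :=
  [/\ descent_direction f s k,
      accepted f sigma theta beta rho M s k (iter_i s k),
      forall i, (i < iter_i s k)%N ->
        ~ accepted f sigma theta beta rho M s k i,
      iter_x s k.+1 = trial beta s k (iter_i s k) &
      iter_alpha s k.+1 = beta ^ ((iter_i s k)%:Z - 1) * iter_alpha s k].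

Definition direction_bounds f (c1 c2 : R) s k : Prop :=
  slope f s k <= - c1 * enorm (grad f (iter_x s k)) ^+ 2 /\
  enorm (iter_d s k) <= c2 * enorm (grad f (iter_x s k)).

(* Whenever iterations 0, ..., k-1 have been performed and d_k has been
   computed, all directions so far obeying the bounds with constants c1, c2,
   the inner loop of iteration k terminates. *)
Definition well_defined f x0 alpha0 sigma theta beta rho M c1 c2 : Prop :=
  forall s k,
    initialized x0 alpha0 s ->
    (forall j, (j < k)%N -> iteration f sigma theta beta rho M s j) ->
    descent_direction f s k ->
    (forall j, (j <= k)%N -> direction_bounds f c1 c2 s j) ->
    exists i, accepted f sigma theta beta rho M s k i.

Definition generated f x0 alpha0 sigma theta beta rho M s : Prop :=
  initialized x0 alpha0 s /\
  forall k, iteration f sigma theta beta rho M s k.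

End Algorithm.

(* Main.v *)
Require Import Defs.
From HB Require Import structures.
From mathcomp Require Import all_boot all_order all_algebra.
From mathcomp Require Import all_classical all_reals all_analysis.
From mathcomp Require Import ring lra.
Set Implicit Arguments.
Unset Strict Implicit.
Unset Printing Implicit Defensive.
Import Order.TTheory GRing.Theory Num.Theory.
Import numFieldNormedType.Exports.
Local Open Scope ring_scope.

(** Write [g_k] for the norm of the gradient at [x_k] and [a_k] for the step size
    accepted at iteration [k].

    By the descent lemma ([descent_lemma]), every step size up to
    [thr = 2 (1 - rho) c1 / (L c2 ^ 2)] satisfies the Armijo condition
    ([sufficient_decrease]), hence the relaxed acceptance test, because
    [nu_{k,i} >= 0] ([accepted_short_step]). Backtracking therefore ends as soon
    as the step size is below [thr]. It also never produces a small initial step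
    size: [alpha_{k+1} = a_k / beta] is either larger than [alpha_k], when the
    first trial is accepted, or a rejected step size, which exceeds [thr]; so
    [alpha_k >= min (alpha_0, thr)] for every [k] ([initial_step_ge]), and
    [a_k = beta alpha_{k+1} >= beta min (alpha_0, thr)].

    Inserting this in the acceptance test gives
    [g_k ^ 2 <= Lt (f x_k - f x_{k+1} + nu_k)], where [Lt] is the inverse of
    [rho c1 beta min (alpha_0, thr)] ([rate_constantE], [iteration_decrease]).
    The function values telescope over [k < T], and
    [nu_k <= sigma (k + 1) ^ (- theta)] since the maximum in the exponent is at
    least [theta]; so [T] times the least [g_k ^ 2] is at most
    [Lt (f x_0 - f_low + sigma \sum_(1 <= j <= T) j ^ (- theta))]
    ([min_grad_le]). The three cases of the theorem are the comparison of this sum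
    with the integral of [t ^ (- theta)] over [1, T]. *)

(** * Euclidean inner product and norm *)

Lemma dotBl (R : realType) (n : nat) (u v w : 'rV[R]_n) :
  dot (u - v) w = dot u w - dot v w.
Proof. by rewrite /dot -sumrB; apply: eq_bigr => j _; rewrite !mxE mulrBl. Qed.

Lemma dotZr (R : realType) (n : nat) (a : R) (u v : 'rV[R]_n) :
  dot u (a *: v) = a * dot u v.
Proof.
by rewrite /dot mulr_sumr; apply: eq_bigr => j _; rewrite mxE mulrCA.
Qed.

Lemma dotC (R : realType) (n : nat) (u v : 'rV[R]_n) : dot u v = dot v u.
Proof. by apply: eq_bigr => j _; rewrite mulrC. Qed.

Lemma dotBr (R : realType) (n : nat) (u v w : 'rV[R]_n) :
  dot u (v - w) = dot u v - dot u w.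
Proof. by rewrite dotC dotBl ![dot _ u]dotC. Qed.

Lemma dotZl (R : realType) (n : nat) (a : R) (u v : 'rV[R]_n) :
  dot (a *: u) v = a * dot u v.
Proof. by rewrite dotC dotZr dotC. Qed.

Lemma dot_ge0 (R : realType) (n : nat) (u : 'rV[R]_n) : 0 <= dot u u.
Proof. by apply: sumr_ge0 => j _; rewrite -expr2 sqr_ge0. Qed.

Lemma enorm_ge0 (R : realType) (n : nat) (u : 'rV[R]_n) : 0 <= enorm u.
Proof. exact: sqrtr_ge0. Qed.

Lemma enorm_sqr (R : realType) (n : nat) (u : 'rV[R]_n) :
  enorm u ^+ 2 = dot u u.
Proof. by rewrite sqr_sqrtr ?dot_ge0. Qed.

Lemma enormZ (R : realType) (n : nat) (a : R) (u : 'rV[R]_n) :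
  enorm (a *: u) = `|a| * enorm u.
Proof.
by rewrite /enorm dotZr dotZl mulrA -expr2 sqrtrM ?sqr_ge0// sqrtr_sqr.
Qed.

Lemma enorm_eq0 (R : realType) (n : nat) (u : 'rV[R]_n) :
  enorm u = 0 -> u = 0.
Proof.
move=> u0; have /eqP : dot u u = 0 by rewrite -enorm_sqr u0 expr0n.
rewrite psumr_eq0 => [|j _]; last by rewrite -expr2 sqr_ge0.
move=> /allP u_eq0; apply/rowP => j; apply/eqP; rewrite mxE.
by have := u_eq0 j (mem_index_enum j); rewrite /= mulf_eq0 orbb.
Qed.

(** Nonnegativity of the squared norm of [|v| u - |u| v], which equals
    [2 |u| |v| (|u| |v| - <u, v>)]. *)
Lemma dot_le_enorm (R : realType) (n : nat) (u v : 'rV[R]_n) :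
  dot u v <= enorm u * enorm v.
Proof.
have [u0|u_neq0] := eqVneq (enorm u) 0.
  rewrite u0 mul0r (enorm_eq0 u0) /dot big1// => j _.
  by rewrite mxE mul0r.
have [v0|v_neq0] := eqVneq (enorm v) 0.
  rewrite v0 mulr0 (enorm_eq0 v0) /dot big1// => j _.
  by rewrite mxE mulr0.
have u_gt0 : 0 < enorm u by rewrite lt_def u_neq0 enorm_ge0.
have v_gt0 : 0 < enorm v by rewrite lt_def v_neq0 enorm_ge0.
have := dot_ge0 (enorm v *: u - enorm u *: v).
rewrite !(dotBl, dotBr, dotZl, dotZr) -!enorm_sqr [dot v u]dotC.
set a := enorm u in u_gt0 *; set b := enorm v in v_gt0 *.
rewrite (_ : _ - _ = 2 * a * b * (a * b - dot u v)); last by ring.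
by rewrite pmulr_rge0 ?subr_ge0// !mulr_gt0.
Qed.

(** * The descent lemma for a function with Lipschitz gradient *)

Lemma derive_grad (R : realType) (n : nat) (f : 'rV[R]_n -> R)
    (x v : 'rV[R]_n) :
  differentiable f x -> 'D_v f x = dot (grad f x) v.
Proof.
move=> f_diff; rewrite deriveE// {1}(row_sum_delta v) linear_sum.
apply: eq_bigr => j _.
by rewrite linearZ/= mxE deriveE// mulrC.
Qed.

Lemma is_derive_line (R : realType) (n : nat) (f : 'rV[R]_n -> R)
    (x v : 'rV[R]_n) (u : R) :
  differentiable f (x + u *: v) ->
  is_derive u (1 : R) (fun t : R => f (x + t *: v))
    (dot (grad f (x + u *: v)) v).
Proof.
move=> f_diff.
(* Both difference quotients are the same function of the increment. *)
have quotE : (fun h : R => h^-1 *: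
      (((fun t : R => f (x + t *: v)) \o shift u) (h *: (1 : R))
        - f (x + u *: v))) =
    (fun h : R => h^-1 *: ((f \o shift (x + u *: v)) (h *: v)
        - f (x + u *: v))).
  apply/funext => h /=; congr (_ *: (f _ - _)).
  by rewrite [h *: 1]mulr1 scalerDl addrCA.
apply: DeriveDef.
  rewrite /derivable quotE.
  exact: (diff_derivable f_diff).
rewrite -derive_grad// /derive; congr (lim _).
by rewrite quotE.
Qed.

(** Along the segment, [t |-> f (x + t v) - t <grad f x, v> - t^2 L |v|^2 / 2]
    has derivative [<grad f (x + t v) - grad f x, v> - t L |v|^2], which the
    Cauchy-Schwarz inequality and the Lipschitz bound make nonpositive. *)
Lemma descent_lemma (R : realType) (n : nat) (f : 'rV[R]_n -> R) (L : R)
    (f_diff : forall x, differentiable f x)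
    (grad_lip : forall x y,
      enorm (grad f x - grad f y) <= L * enorm (x - y))
    (x v : 'rV[R]_n) :
  f (x + v) <= f x + dot (grad f x) v + L / 2 * enorm v ^+ 2.
Proof.
pose S := dot (grad f x) v; pose D := L * enorm v ^+ 2.
pose psi (t : R) : R := f (x + t *: v) - t * S - t ^+ 2 * (D / 2).
pose dpsi (t : R) : R := dot (grad f (x + t *: v)) v - S - t * D.
have psi_derive (t : R) : is_derive t (1 : R) psi (dpsi t).
  have line := is_derive_line (f_diff (x + t *: v)).
  rewrite /psi /dpsi; apply: is_derive_eq.
  rewrite /= /GRing.scale/=; move: (dot _ v) => g; clearbody S D.
  by rewrite !mulr0 !mulr1 !add0r; field.
have psi_cont : {within `[0, 1], continuous psi}%classic.
  apply: derivable_within_continuous => r _.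
  by have dr := psi_derive r; exact: ex_derive.
have [c] := MVT_segment ler01 (fun t _ => psi_derive t) psi_cont.
rewrite in_itv/= => /andP[c_ge0 _].
rewrite subr0 mulr1 => psi01.
have : dpsi c <= 0.
  rewrite /dpsi /S -dotBl subr_le0; apply: (le_trans (dot_le_enorm _ _)).
  have := ler_wpM2r (enorm_ge0 v) (grad_lip (x + c *: v) x).
  rewrite addrAC subrr add0r enormZ ger0_norm// => /le_trans; apply.
  by rewrite /D expr2 !mulrA [L * c]mulrC.
rewrite -psi01 /psi scale1r scale0r addr0 /D /S; lra.
Qed.

(** * Partial sums of [k ^ (- theta)] *)

(** The mean value theorem on [k, k + 1] gives a [c <= k + 1] with
    [F (k + 1) - F k = c ^ (- theta) >= (k + 1) ^ (- theta)]. A primitive [F] is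
    a parameter because [theta = 1] needs the logarithm instead of a power. *)
Lemma sum_powRN_le (R : realType) (theta : R) (F : R -> R) (T : nat) :
  0 <= theta ->
  (forall t : R, 0 < t -> is_derive t (1 : R) F (t `^ (- theta))) ->
  \sum_(k < T.+1) k.+1%:R `^ (- theta) <= 1 + (F T.+1%:R - F 1).
Proof.
move=> theta_ge0 F_derive; elim: T => [|T IHT].
  by rewrite big_ord1 powR1 subrr addr0.
rewrite big_ord_recr/=.
suff step : T.+2%:R `^ (- theta) <= F T.+2%:R - F T.+1%:R.
  by apply: (le_trans (lerD IHT step)); lra.
have pos (t : R) : T.+1%:R <= t -> 0 < t by apply: lt_le_trans; rewrite ltr0n.
have F_derive' (t : R) : t \in `]T.+1%:R, T.+2%:R[ ->
    is_derive t (1 : R) F (t `^ (- theta)).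
  by rewrite in_itv/= => /andP[/ltW/pos t_gt0 _]; exact: F_derive.
have F_cont : {within `[T.+1%:R, T.+2%:R], continuous F}%classic.
  apply: derivable_within_continuous => t.
  rewrite in_itv/= => /andP[/pos t_gt0 _].
  by have dt := F_derive t t_gt0; exact: ex_derive.
have T_le : T.+1%:R <= T.+2%:R :> R by rewrite ler_nat.
have [c] := MVT_segment T_le F_derive' F_cont.
rewrite in_itv/= => /andP[Tc cT] ->.
rewrite -natrB// subSnn mulr1 !powRN lef_pV2 ?posrE ?powR_gt0 ?ltr0n// ?pos//.
by apply: ge0_ler_powR => //; rewrite nnegrE ?ler0n// ltW// pos.
Qed.

Lemma is_derive_powR_primitive (R : realType) (theta t : R) :
  theta != 1 -> 0 < t ->
  is_derive t (1 : R) (fun u : R => u `^ (1 - theta) / (1 - theta))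
    (t `^ (- theta)).
Proof.
move=> theta_neq1 t_gt0.
have theta_neq1' : 1 - theta != 0 by rewrite subr_eq0 eq_sym.
have pow_derive := is_derive1_powR (1 - theta) t_gt0.
apply: is_derive_eq.
rewrite /GRing.scale/= [1 - theta - 1]addrAC subrr add0r.
by rewrite !mulr0 add0r mulKf.
Qed.

Lemma sum_powRN_gt1 (R : realType) (theta : R) (T : nat) :
  1 < theta ->
  \sum_(k < T.+1) k.+1%:R `^ (- theta) <= theta / (theta - 1).
Proof.
move=> theta_gt1; have theta_neq1 : theta != 1 by rewrite gt_eqF.
have theta_ge0 : 0 <= theta by rewrite ltW// (lt_trans ltr01).
apply: (le_trans (sum_powRN_le T theta_ge0
  (fun t => is_derive_powR_primitive theta_neq1))).
have d_gt0 : 0 < theta - 1 by rewrite subr_gt0.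
rewrite powR1 -(opprB theta) invrN !mulrN opprK mul1r.
have : 0 <= T.+1%:R `^ (- (theta - 1)) / (theta - 1).
  by rewrite divr_ge0 ?powR_ge0 ?ltW.
have -> : theta / (theta - 1) = 1 + (theta - 1)^-1 by field; rewrite gt_eqF.
lra.
Qed.

Lemma sum_invr_le (R : realType) (T : nat) :
  \sum_(k < T.+1) (k.+1%:R : R) `^ (- 1) <= 1 + ln T.+1%:R.
Proof.
have ln_derive (t : R) : 0 < t -> is_derive t (1 : R) (@ln R) (t `^ (- 1)).
  by move=> t_gt0; rewrite powR_inv1 ?ltW//; exact: is_derive1_ln.
by have := sum_powRN_le T ler01 ln_derive; rewrite ln1 subr0.
Qed.

Lemma sum_powRN_lt1 (R : realType) (theta : R) (T : nat) :
  0 < theta < 1 ->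
  \sum_(k < T.+1) k.+1%:R `^ (- theta) <=
    T.+1%:R `^ (1 - theta) / (1 - theta).
Proof.
move=> /andP[theta_gt0 theta_lt1].
have theta_neq1 : theta != 1 by rewrite lt_eqF.
apply: (le_trans (sum_powRN_le T (ltW theta_gt0)
  (fun t => is_derive_powR_primitive theta_neq1))).
have d_gt0 : 0 < 1 - theta by rewrite subr_gt0.
rewrite powR1.
(* The first term and the lower limit together contribute at most 0. *)
have : 1 <= 1 / (1 - theta) by rewrite ler_pdivlMr// mul1r gerBl ltW.
lra.
Qed.

(** * The line search *)

Section LineSearch.
Context (R : realType) (n : nat) (f : 'rV[R]_n -> R).
Implicit Types (s : execution R n) (k i : nat).

(** Step sizes up to this threshold satisfy the monotone sufficient decrease
    condition: there the quadratic error of the descent lemma is absorbed by the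
    fraction [1 - rho] of the predicted decrease. *)
Definition step_threshold (L rho c1 c2 : R) : R :=
  2 * (1 - rho) * c1 / (L * c2 ^+ 2).

Lemma sufficient_decrease (L rho c1 c2 t : R) (x d : 'rV[R]_n) :
  0 < L -> 0 < c2 -> rho < 1 ->
  (forall x, differentiable f x) ->
  (forall x y, enorm (grad f x - grad f y) <= L * enorm (x - y)) ->
  dot (grad f x) d <= - c1 * enorm (grad f x) ^+ 2 ->
  enorm d <= c2 * enorm (grad f x) ->
  0 <= t <= step_threshold L rho c1 c2 ->
  f (x + t *: d) <= f x + rho * t * dot (grad f x) d.
Proof.
move=> L_gt0 c2_gt0 rho_lt1 f_diff grad_lip slope_le d_le /andP[t_ge0 t_le].
apply: (le_trans (descent_lemma f_diff grad_lip x (t *: d))).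
rewrite dotZr enormZ ger0_norm//.
set S := dot _ _ in slope_le *; set g := enorm (grad f x) in slope_le d_le *.
have g_ge0 : 0 <= g := enorm_ge0 _.
have d2_le : enorm d ^+ 2 <= c2 ^+ 2 * g ^+ 2.
  by rewrite -exprMn lerXn2r ?nnegrE ?enorm_ge0// mulr_ge0// ltW.
have tLc_le : t * (L * c2 ^+ 2) <= 2 * (1 - rho) * c1.
  by rewrite -ler_pdivlMr// mulr_gt0// exprn_gt0.
have quad_le : L * t * enorm d ^+ 2 <= 2 * (1 - rho) * (c1 * g ^+ 2).
  apply: (@le_trans _ _ (L * t * (c2 ^+ 2 * g ^+ 2))).
    by rewrite ler_wpM2l// mulr_ge0// ltW.
  have := ler_wpM2r (sqr_ge0 g) tLc_le.
  lra.
have slope_le' : (1 - rho) * (c1 * g ^+ 2) <= (1 - rho) * - S.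
  by apply: ler_wpM2l; [rewrite subr_ge0 ltW|lra].
have : t * (L * t * enorm d ^+ 2) <= t * (2 * ((1 - rho) * - S)).
  by rewrite ler_wpM2l//; lra.
rewrite exprMn; lra.
Qed.

Lemma nu_ge0 (sigma theta beta rho : R) (M : nat) s k i :
  0 < sigma -> 0 <= nu f sigma theta beta rho M s k i.
Proof. by move=> sigma_gt0; rewrite mulr_ge0 ?expR_ge0 ?ltW. Qed.

(** The second argument of the maximum can only enlarge the factor of
    [ln (k + 1)], which is nonnegative. *)
Lemma nu_le (sigma theta beta rho : R) (M : nat) s k i :
  0 < sigma ->
  nu f sigma theta beta rho M s k i <= sigma * k.+1%:R `^ (- theta).
Proof.
move=> sigma_gt0; rewrite ler_pM2l// /powR pnatr_eq0/= ler_expR mulNr lerN2.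
by rewrite ler_wpM2r ?le_max ?lexx// ln_ge0// ler1n.
Qed.

Context (L alpha0 sigma theta beta rho c1 c2 : R) (M : nat) (x0 : 'rV[R]_n)
  (L_gt0 : 0 < L)
  (f_diff : forall x, differentiable f x)
  (grad_lip : forall x y, enorm (grad f x - grad f y) <= L * enorm (x - y))
  (alpha0_gt0 : 0 < alpha0) (sigma_gt0 : 0 < sigma)
  (beta_bounds : 0 < beta < 1) (rho_bounds : 0 < rho < 1)
  (c1_gt0 : 0 < c1) (c2_gt0 : 0 < c2).

Let thr := step_threshold L rho c1 c2.

Lemma beta_gt0 : 0 < beta. Proof. by case/andP: beta_bounds. Qed.

Lemma step_threshold_gt0 : 0 < thr.
Proof.
case/andP: rho_bounds => _ rho_lt1.
by rewrite divr_gt0 ?mulr_gt0 ?exprn_gt0 ?subr_gt0.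
Qed.

Lemma accepted_short_step s k i :
  direction_bounds f c1 c2 s k -> 0 <= iter_alpha s k ->
  beta ^+ i * iter_alpha s k <= thr ->
  accepted f sigma theta beta rho M s k i.
Proof.
move=> [slope_le d_le] alpha_ge0 step_le.
case/andP: rho_bounds => _ rho_lt1.
have step_ge0 : 0 <= beta ^+ i * iter_alpha s k.
  by rewrite mulr_ge0// exprn_ge0// ltW// beta_gt0.
rewrite /accepted -[leLHS]addr0 lerD ?nu_ge0// /trial -(mulrA rho).
apply: (sufficient_decrease L_gt0 c2_gt0 rho_lt1 f_diff grad_lip slope_le d_le).
by rewrite step_ge0.
Qed.

(** If the line search of iteration [j] backtracks, then the last rejected step
    size, which is the next initial one, exceeds the threshold; otherwise the
    next initial step size is [alpha_j / beta], larger than [alpha_j]. *)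
Lemma initial_step_ge s k :
  initialized x0 alpha0 s ->
  (forall j, (j < k)%N -> iteration f sigma theta beta rho M s j) ->
  (forall j, (j < k)%N -> direction_bounds f c1 c2 s j) ->
  Num.min alpha0 thr <= iter_alpha s k.
Proof.
move=> [_ s_alpha0]; elim: k => [_ _|k IHk iters bounds].
  by rewrite s_alpha0 ge_min lexx.
have {}IHk : Num.min alpha0 thr <= iter_alpha s k.
  by apply: IHk => j jk; [apply: iters|apply: bounds]; rewrite ltnW.
have alpha_gt0 : 0 < iter_alpha s k.
  by apply: lt_le_trans IHk; rewrite lt_min alpha0_gt0 step_threshold_gt0.
have [_ _ rejected _ ->] := iters k (ltnSn k).
case: (iter_i s k) rejected => [_|i rejected].
  rewrite sub0r exprN1 (le_trans IHk)// ler_peMl ?(ltW alpha_gt0)//.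
  rewrite invf_ge1 ?beta_gt0//.
  by case/andP: beta_bounds => _ /ltW.
rewrite -addn1 PoszD addrK -exprnP ge_min; apply/orP; right.
rewrite leNgt; apply/negP => /ltW step_le.
apply: (rejected i) => //.
by apply: accepted_short_step => //; [exact: bounds|exact: ltW].
Qed.

Lemma line_search_terminates :
  well_defined f x0 alpha0 sigma theta beta rho M c1 c2.
Proof.
move=> s k init iters _ bounds.
have alpha_gt0 : 0 < iter_alpha s k.
  apply: lt_le_trans (initial_step_ge init iters _).
    by rewrite lt_min alpha0_gt0 step_threshold_gt0.
  by move=> j jk; apply: bounds; rewrite ltnW.
have beta_cvg : ((fun i => beta ^+ i : R) @ \oo --> (0 : R))%classic.
  apply: cvg_expr; rewrite ger0_norm ?(ltW beta_gt0)//.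
  by case/andP: beta_bounds.
have thr_gt0 : 0 < thr / iter_alpha s k by rewrite divr_gt0 ?step_threshold_gt0.
have [i _ /(_ i (leqnn i))] := cvgr0_norm_le _ beta_cvg _ thr_gt0.
rewrite /= ger0_norm ?exprn_ge0 ?(ltW beta_gt0)// ler_pdivlMr// => step_le.
by exists i; apply: accepted_short_step => //; [exact: bounds|exact: ltW].
Qed.

(** * Decrease per iteration and its sum *)

Definition rate_constant : R :=
  Num.max (1 / (rho * beta * alpha0 * c1))
          (L / (2 * rho * (1 - rho) * beta) * (c2 / c1) ^+ 2).

(** The accepted step is [beta] times the next initial one, and [rate_constant]
    is the inverse of [rho c1 beta] times the lower bound on the latter. *)
Lemma rate_constantE :
  rate_constant * (rho * c1 * (beta * Num.min alpha0 thr)) = 1.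
Proof.
case/andP: rho_bounds => rho_gt0 rho_lt1; have b_gt0 := beta_gt0.
have thr_gt0 := step_threshold_gt0.
have rate1 : 1 / (rho * beta * alpha0 * c1) = (rho * beta * c1)^-1 * alpha0^-1.
  by field; rewrite !gt_eqF.
have rate2 : L / (2 * rho * (1 - rho) * beta) * (c2 / c1) ^+ 2
    = (rho * beta * c1)^-1 * thr^-1.
  by rewrite /thr /step_threshold; field; rewrite !gt_eqF// subr_gt0.
have p_gt0 : 0 < (rho * beta * c1)^-1 by rewrite invr_gt0 !mulr_gt0.
rewrite /rate_constant rate1 rate2 -maxr_pMr ?(ltW p_gt0)//.
have [alpha0_le|thr_lt] := leP alpha0 thr.
  by rewrite max_l ?lef_pV2 ?posrE//; field; rewrite !gt_eqF//.
by rewrite max_r ?lef_pV2 ?posrE ?(ltW thr_lt)//; field; rewrite !gt_eqF//.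
Qed.

Lemma rate_constant_gt0 : 0 < rate_constant.
Proof.
case/andP: rho_bounds => rho_gt0 _; have b_gt0 := beta_gt0.
by rewrite lt_max divr_gt0// !mulr_gt0.
Qed.

Lemma iteration_decrease s k :
  generated f x0 alpha0 sigma theta beta rho M s ->
  (forall j, direction_bounds f c1 c2 s j) ->
  enorm (grad f (iter_x s k)) ^+ 2 <=
    rate_constant * (f (iter_x s k) - f (iter_x s k.+1)
                     + sigma * k.+1%:R `^ (- theta)).
Proof.
move=> [init iters] bounds; case/andP: rho_bounds => rho_gt0 _.
have next_ge := @initial_step_ge s k.+1 init (fun j _ => iters j)
  (fun j _ => bounds j).
have [_ acc _ xE alphaE] := iters k; have [slope_le _] := bounds k.
have b_gt0 := beta_gt0.
have stepE : beta ^+ iter_i s k * iter_alpha s k = beta * iter_alpha s k.+1.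
  rewrite alphaE mulrA; congr (_ * _).
  by rewrite expfzDr ?gt_eqF// exprN1 -exprnP mulrCA mulfV ?mulr1 ?gt_eqF.
move: acc; rewrite /accepted -xE -(mulrA rho) stepE => acc.
have nu_bound := nu_le theta beta rho M s k (iter_i s k) sigma_gt0.
set g := enorm _ in slope_le *; set a := iter_alpha s k.+1 in next_ge acc *.
have g2_ge0 : 0 <= g ^+ 2 := sqr_ge0 _.
have step_le : beta * Num.min alpha0 thr <= beta * a.
  by rewrite ler_wpM2l ?(ltW b_gt0).
have m_gt0 : 0 < beta * Num.min alpha0 thr.
  by rewrite mulr_gt0// lt_min alpha0_gt0 step_threshold_gt0.
have a_gt0 := lt_le_trans m_gt0 step_le.
have slope_bound : rho * (beta * a) * slope f s k
    <= - (rho * c1 * (beta * a) * g ^+ 2).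
  have := ler_wpM2l (ltW (mulr_gt0 rho_gt0 a_gt0)) slope_le.
  by lra.
have min_bound : rho * c1 * (beta * Num.min alpha0 thr) * g ^+ 2
    <= rho * c1 * (beta * a) * g ^+ 2.
  by rewrite ler_wpM2r// ler_wpM2l// ltW// mulr_gt0.
rewrite -[leLHS]mul1r -[X in X * _ <= _]rate_constantE -(mulrA rate_constant).
rewrite ler_pM2l ?rate_constant_gt0//; lra.
Qed.

(** The minimum is at most the average, and the sum over the iterations of the
    bounds on the squared gradient norms telescopes. *)
Lemma min_grad_le s f_low (T : nat) :
  (forall x, f_low <= f x) ->
  generated f x0 alpha0 sigma theta beta rho M s ->
  (forall j, direction_bounds f c1 c2 s j) ->
  \big[Num.min/enorm (grad f (iter_x s 0)) ^+ 2]_(k < T.+1)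
      enorm (grad f (iter_x s k)) ^+ 2 <=
    rate_constant * (f x0 - f_low
                     + sigma * \sum_(k < T.+1) k.+1%:R `^ (- theta)) / T.+1%:R.
Proof.
move=> f_bounded gen bounds; set m := bigop _ _ _.
rewrite ler_pdivlMr ?ltr0n// mulr_natr.
apply: (@le_trans _ _ (\sum_(k < T.+1) enorm (grad f (iter_x s k)) ^+ 2)).
  rewrite -[X in _ *+ X](card_ord T.+1) -sumr_const; apply: ler_sum => k _.
  exact: bigmin_le.
apply: le_trans (ler_sum _ _) _.
  by move=> k _; exact: iteration_decrease.
rewrite -mulr_sumr ler_pM2l ?rate_constant_gt0// big_split/= -mulr_sumr lerD2r.
rewrite -(big_mkord xpredT (fun k => f (iter_x s k) - f (iter_x s k.+1))).
rewrite -lerN2 -sumrN; under eq_bigr do rewrite opprB.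
rewrite telescope_sumr// opprB; case: gen => -[-> _] _.
by rewrite lerD2r.
Qed.

End LineSearch.

(** * The convergence rate *)

Theorem lemma2p1 (R : realType) (n : nat) (f : 'rV[R]_n -> R) (L f_low : R)
    (x0 : 'rV[R]_n) (alpha0 sigma theta beta rho : R) (M : nat) (c1 c2 : R)
    (L_gt0 : 0 < L)
    (f_diff : forall x, differentiable f x)
    (grad_lip : forall x y,
      enorm (grad f x - grad f y) <= L * enorm (x - y))
    (f_bounded : forall x, f_low <= f x)
    (alpha0_gt0 : 0 < alpha0) (sigma_gt0 : 0 < sigma) (theta_gt0 : 0 < theta)
    (beta_bounds : 0 < beta < 1) (rho_bounds : 0 < rho < 1) (M_gt0 : (0 < M)%N)
    (c1_gt0 : 0 < c1) (c2_gt0 : 0 < c2) :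
  let Lt := Num.max (1 / (rho * beta * alpha0 * c1))
                    (L / (2 * rho * (1 - rho) * beta) * (c2 / c1) ^+ 2) in
  well_defined f x0 alpha0 sigma theta beta rho M c1 c2 /\
  forall s : execution R n,
    generated f x0 alpha0 sigma theta beta rho M s ->
    (forall k, direction_bounds f c1 c2 s k) ->
    forall T : nat, (1 <= T)%N ->
      let min_sq := \big[Num.min/enorm (grad f (iter_x s 0)) ^+ 2]_(k < T)
                       enorm (grad f (iter_x s k)) ^+ 2 in
      [/\ 1 < theta ->
            min_sq <= Lt * (f x0 - f_low) / T%:R
                      + Lt * sigma * theta / (theta - 1) * (1 / T%:R),
          theta = 1 ->
            min_sq <= Lt * (f x0 - f_low) / T%:R
                      + Lt * sigma * ((1 + ln T%:R) / T%:R) &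
          theta < 1 ->
            min_sq <= Lt * (f x0 - f_low) / T%:R
                      + Lt * sigma / (1 - theta) * (1 / (T%:R `^ theta))].
Proof.
move=> Lt; split; first exact: (line_search_terminates L_gt0).
move=> s gen bounds [//|T] _ min_sq.
have Lt_gt0 : 0 < Lt.
  exact: (rate_constant_gt0 L c2 alpha0_gt0 beta_bounds rho_bounds c1_gt0).
have T_gt0 : 0 < T.+1%:R :> R by rewrite ltr0n.
have bound (B : R) : \sum_(k < T.+1) k.+1%:R `^ (- theta) <= B ->
    min_sq <= Lt * (f x0 - f_low) / T.+1%:R + Lt * sigma * (B / T.+1%:R).
  move=> sum_le.
  apply: (le_trans (min_grad_le L_gt0 f_diff grad_lip alpha0_gt0 sigma_gt0
    beta_bounds rho_bounds c1_gt0 c2_gt0 T f_bounded gen bounds)).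
  rewrite -[rate_constant _ _ _ _ _ _]/Lt.
  rewrite !mulrA -mulrDl ler_wpM2r ?invr_ge0 ?(ltW T_gt0)//.
  rewrite mulrDr lerD2l -!mulrA.
  by rewrite !ler_pM2l.
split=> theta_cmp.
- apply: (le_trans (bound _ (sum_powRN_gt1 T theta_cmp))).
  by rewrite mul1r !mulrA.
- by apply: bound; rewrite theta_cmp; exact: sum_invr_le.
- have theta01 : 0 < theta < 1 by rewrite theta_gt0.
  apply: (le_trans (bound _ (sum_powRN_lt1 T theta01))).
  have -> : T.+1%:R `^ (1 - theta) = T.+1%:R / T.+1%:R `^ theta :> R.
    by rewrite powRB ?pnatr_eq0 ?implybT// powRr1// ler0n.
  rewrite lerD2l le_eqVlt; apply/orP; left; apply/eqP; field.
  by rewrite !gt_eqF// ?powR_gt0// subr_gt0.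
Qed.
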